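(* Let $n\geqslant 3$ and fix an $n\times n$ matrix $\mathbf f=\(f_{i,j}(X_{i,j})\)_{1\leqslant i,j\leqslant n}$ of non-constant polynomials $f_{i,j}\in\mathbb{Z}[X_{i,j}]$. Let $p$ be a sufficiently large prime. Then for any positive integer $H\leqslant p/2$, \[ N_{\mathbf f}(H,p)=\frac{1}{p}(2H+1)^{n^2}+O\(p^{(n^2-1)/2+o(1)}+H^{n^2-2}p^{1/2+o(1)}\)\qquad\text{as }p\to\infty. \]
   Context: $N_{\mathbf f}(H,p)$ denotes the number of tuples $(x_{i,j})_{1\leqslant i,j\leqslant n}$ of integers in $[-H,H]$ such that $\det\(f_{i,j}(x_{i,j})\)_{1\leqslant i,j\leqslant n}\equiv 0\pmod p$. The implied constant may depend on $n$ and $\mathbf f$. *)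

(* Defs.v *)
From mathcomp Require Import all_boot all_order all_algebra.
From mathcomp Require Import all_classical all_reals all_analysis.

Set Implicit Arguments.
Unset Strict Implicit.
Unset Printing Implicit Defensive.

Import GRing.Theory.
Local Open Scope ring_scope.

(* The ordinal k : 'I_(2 * H + 1) stands for the integer k - H, so that k runs *)
(* through the integers of [-H, H], each exactly once.                         *)
Definition box_val (H : nat) (k : 'I_(2 * H + 1)) : int :=
  (k : nat)%:Z - H%:Z.

Definition det_count (n : nat) (f : 'M[{poly int}]_n) (H p : nat) : nat :=
  #|[set x : 'M['I_(2 * H + 1)]_n |
      (p%:Z %| \det (\matrix_(i, j) (f i j).[box_val (x i j)]))%Z]|.

(* Main.v *)
Require Import Defs.
From mathcomp Require Import all_boot all_order all_algebra.
From mathcomp Require Import all_classical all_reals all_analysis.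
From mathcomp Require Import mxabelem.
From mathcomp Require Import zify ring lra.

(** Let [q] be the order of the field [F_p] and [B = 2H + 1]. Counting pairs of a
    matrix and a nonzero vector [c] of its left kernel gives

      [sum_(c != 0) prod_j M_j(c) = (q - 1) N + (excess of corank >= 2)],

    where [M_j(c)] is the number of columns [j] with entries in the box that are
    orthogonal to [c]. The number of matrices of corank [r] is [O(B^(n^2 - r^2))],
    because [r^2] entries are determined by the others up to boundedly many
    choices; hence the excess is negligible as soon as [B >= sqrt q]. Write
    [M_j = m + Delta_j] with [m = B^n / q]. The linear terms in [Delta_j] are
    computed exactly. The second moment [sum_c Delta_j(c)^2] counts pairs of
    proportional columns, of which there are [O(B^(n + 1))], and this, with the
    bound [|Delta_j(c)| = O(B^(n - 1))] for [c != 0], controls all terms of higher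
    degree. No bound on exponential sums is needed, and both [o(1)] can be taken
    to be [0]. For [B < sqrt q] the count of singular matrices is already
    [O(B^(n^2 - 1))], which is within the error term. *)

Set Implicit Arguments.
Unset Strict Implicit.
Unset Printing Implicit Defensive.

Import Order.TTheory GRing.Theory Num.Theory.
Import numFieldNormedType.Exports.
Local Open Scope ring_scope.

(** * Matrices of given rank with entries in a finite set *)

Lemma card_family_prod (I T : finType) (P : I -> pred T) :
  #|(family P : pred {ffun I -> T})| = (\prod_i #|P i|)%N.
Proof. by rewrite card_family foldrE big_map big_enum. Qed.

(** Once the coordinates outside [S] are fixed, each [g i (x i)] with [i] in [S] takes a single
    value on [E], so [x i] stays in one fibre of [g i]. *)
Lemma card_determined (I T : finType) (F : eqType) (g : I -> T -> F) (D : nat)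
    (S : {set I}) (E : {set {ffun I -> T}}) :
  (forall i a, #|[set t | g i t == a]| <= D)%N ->
  (forall x y, x \in E -> y \in E -> (forall i, i \notin S -> x i = y i) ->
     forall i, i \in S -> g i (x i) = g i (y i)) ->
  (#|E| <= D ^ #|S| * #|T| ^ #|~: S|)%N.
Proof.
move=> gD detE; have [->|[x0 _]] := set_0Vmem E; first by rewrite cards0.
(* [r] forgets the coordinates in [S] by overwriting them with those of [x0]; [E] is cut into the
   fibres of [r]. *)
pose r (x : {ffun I -> T}) := [ffun i => if i \in S then x0 i else x i].
pose P := family (fun i => if i \in S then pred1 (x0 i) else predT).
have cardP : #|P| = (#|T| ^ #|~: S|)%N.
  rewrite card_family_prod (bigID (mem S)) /= big1 ?mul1n => [|i ->]; last first.
    by rewrite card1.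
  rewrite (eq_bigr (fun=> #|T|)) => [|i /negbTE->]; last by rewrite cardT -cardT.
  by rewrite prod_nat_const; congr (_ ^ _)%N; apply: eq_card => i; rewrite !inE.
rewrite -sum1_card (partition_big r (mem P)) /=; last first.
  by move=> x _; apply/familyP => i; rewrite ffunE; case: (i \in S); rewrite inE.
rewrite -cardP mulnC -sum_nat_const; apply: leq_sum => y _.
rewrite sum1_card; set A := (X in #|X|).
have [x1 x1A|A0] := pickP A; last by rewrite (eq_card0 A0).
have /andP[x1E /eqP x1y] : x1 \in A by [].
pose Q := family (fun i => if i \in S then [pred t | g i t == g i (x1 i)]
                           else pred1 (x1 i)).
have sAQ : A \subset Q.
  apply/fintype.subsetP => x /andP[xE /eqP xy]; apply/familyP => i.
  have eqx j : j \notin S -> x j = x1 j.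
    move=> jS; move/ffunP: (etrans xy (esym x1y)) => /(_ j).
    by rewrite !ffunE (negbTE jS).
  case: ifP => [iS|/negbT iS]; rewrite inE /=; last by rewrite eqx.
  by rewrite (detE x x1).
apply: leq_trans (subset_leq_card sAQ) _.
rewrite card_family_prod (bigID (mem S)) /= [X in (_ * X)%N]big1 ?muln1.
  rewrite -prod_nat_const; apply: leq_prod => i iS; rewrite iS.
  by apply: leq_trans (gD i (g i (x1 i))); rewrite leq_eqVlt; apply/orP; left;
    apply/eqP/eq_card => t; rewrite !inE.
by move=> i /negbTE->; rewrite card1.
Qed.

(** Take [s] independent rows of [A], then [s] independent columns of these rows: the minor is
    invertible. Writing [A] as [L] times the chosen rows, [L] is read off from the chosen
    columns. *)
Lemma rank_factorization (F : fieldType) (m n s : nat) (A : 'M[F]_(m, n)) :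
  \rank A = s ->
  exists (u : {ffun 'I_s -> 'I_m}) (v : {ffun 'I_s -> 'I_n}),
    [/\ injective u, injective v
      & A = colsub v A *m invmx (mxsub u v A) *m rowsub u A].
Proof.
move=> <-{s}; pose u := maxrankfun A; pose A1 := rowsub u A.
have fullA1 : row_full A1^T.
  by rewrite /row_full mxrank_tr; exact: maxrowsub_free.
pose v := fullrankfun fullA1.
exists u, v; split; [exact: maxrankfun_inj|exact: fullrankfun_inj|].
have unitA1 : colsub v A1 \in unitmx.
  rewrite -unitmx_tr (_ : _^T = rowsub v A1^T); first exact: fullrowsub_unit.
  by apply/matrixP=> i j; rewrite !mxE.
have /submxP[L defA] : (A <= A1)%MS by rewrite eq_maxrowsub.
have -> : mxsub u v A = colsub v A1 by apply/matrixP=> i j; rewrite !mxE.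
have -> : colsub v A = L *m colsub v A1.
  apply/matrixP=> i j; have /matrixP/(_ i (v j)) := defA.
  by rewrite !mxE => ->; apply: eq_bigr => k _; rewrite !mxE.
by rewrite mulmxK.
Qed.

(** Entries are indices in [T] rather than field elements, so that indices with the same value are
    counted separately. *)
Definition eval_mx (T F : Type) (m n : nat) (g : 'I_m -> 'I_n -> T -> F)
  (X : 'M[T]_(m, n)) : 'M[F]_(m, n) := \matrix_(i, j) g i j (X i j).

(** For fixed rows [u] and columns [v], the factorization determines the values in the complementary
    block, each up to [D] indices. The factor [m ^ s * n ^ s] bounds the choices of [u] and [v]. *)
Lemma card_rank (T : finType) (F : fieldType) (m n s D : nat)
    (g : 'I_m -> 'I_n -> T -> F) :
  (forall i j a, #|[set t | g i j t == a]| <= D)%N ->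
  (#|[set X : 'M[T]_(m, n) | \rank (eval_mx g X) == s]|
   <= m ^ s * n ^ s * (D ^ ((m - s) * (n - s))
                       * #|T| ^ (m * n - (m - s) * (n - s))))%N.
Proof.
move=> gD.
pose E (uv : {ffun 'I_s -> 'I_m} * {ffun 'I_s -> 'I_n}) :=
  [set X : 'M[T]_(m, n) | [&& injectiveb uv.1, injectiveb uv.2 &
     eval_mx g X == colsub uv.2 (eval_mx g X) *m
       invmx (mxsub uv.1 uv.2 (eval_mx g X)) *m rowsub uv.1 (eval_mx g X)]].
set b := (D ^ _ * _)%N.
have sub : [set X : 'M[T]_(m, n) | \rank (eval_mx g X) == s]
           \subset \bigcup_uv E uv.
  apply/fintype.subsetP => X; rewrite inE => /eqP /rank_factorization[u [v [iu iv defX]]].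
  apply/bigcupP; exists (u, v) => //; rewrite inE /= -defX eqxx andbT.
  by apply/andP; split; apply/injectiveP.
apply: leq_trans (subset_leq_card sub) _.
apply: leq_trans (_ : \sum_uv #|E uv| <= _)%N.
  elim/big_rec2: _ => [|uv k A _ IH]; first by rewrite cards0.
  by rewrite cardsU (leq_trans (leq_subr _ _)) // leq_add2l.
apply: leq_trans (_ : \sum_(uv : {ffun 'I_s -> 'I_m} * {ffun 'I_s -> 'I_n}) b <= _)%N;
  last by rewrite sum_nat_const card_prod !card_ffun !card_ord.
apply: leq_sum => -[u v] _.
have [/andP[/injectiveP iu /injectiveP iv]|ninj] :=
  boolP (injectiveb u && injectiveb v); last first.
  rewrite (_ : E _ = finset.set0) ?cards0 //; apply/setP => X.
  by rewrite !inE /= andbA (negbTE ninj).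
pose S := finset.setX (~: (u @: 'I_s)) (~: (v @: 'I_s)).
have cardS : #|S| = ((m - s) * (n - s))%N.
  have cardC k (w : {ffun 'I_s -> 'I_k}) : injective w ->
      #|~: (w @: 'I_s)| = (k - s)%N.
    by move=> iw; rewrite cardsCs finset.setCK card_imset // !card_ord.
  by rewrite cardsX !cardC.
have cardCS : #|~: S| = (m * n - (m - s) * (n - s))%N.
  by rewrite cardsCs finset.setCK card_prod !card_ord cardS.
pose toF (X : 'M[T]_(m, n)) := [ffun ij : 'I_m * 'I_n => X ij.1 ij.2].
have injF : injective toF.
  by move=> X Y /ffunP eXY; apply/matrixP => i j; have := eXY (i, j); rewrite !ffunE.
rewrite -(card_imset _ injF) /b -cardCS -cardS.
apply: (@card_determined _ _ _ (fun ij => g ij.1 ij.2)) => [ij a|]; first exact: gD.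
move=> _ _ /imsetP[X XE ->] /imsetP[Y YE ->] eXY [i j] _; rewrite !ffunE /=.
have eqXY k l : (k \in u @: 'I_s) || (l \in v @: 'I_s) -> X k l = Y k l.
  by move=> kl; have := eXY (k, l); rewrite !ffunE /= => -> //; rewrite !inE negb_and !negbK.
have er : rowsub u (eval_mx g X) = rowsub u (eval_mx g Y).
  by apply/matrixP => k l; rewrite !mxE eqXY // imset_f.
have ec : colsub v (eval_mx g X) = colsub v (eval_mx g Y).
  by apply/matrixP => k l; rewrite !mxE eqXY // orbC imset_f.
have em : mxsub u v (eval_mx g X) = mxsub u v (eval_mx g Y).
  by apply/matrixP => k l; rewrite !mxE eqXY // imset_f.
move: XE YE; rewrite !inE /= => /and3P[_ _ /eqP dX] /and3P[_ _ /eqP dY].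
have /matrixP/(_ i j) : eval_mx g X = eval_mx g Y by rewrite dX dY er ec em.
by rewrite !mxE.
Qed.

(** * Left kernel vectors and orthogonal columns *)

Lemma card_left_kernel (F : finFieldType) (n k : nat) (A : 'M[F]_(n, k)) :
  #|[set c : 'rV[F]_n | c *m A == 0]| = (#|F| ^ (n - \rank A))%N.
Proof.
rewrite -mxrank_ker -card_rowg; apply: eq_card => c.
by rewrite mem_rowg inE; apply/eqP/sub_kermxP.
Qed.

Definition orth_count (T : finType) (F : finFieldType) (n : nat)
    (h : 'I_n -> T -> F) (c : 'rV[F]_n) : nat :=
  #|[set x : {ffun 'I_n -> T} | \sum_i c 0 i * h i (x i) == 0]|.

Lemma prod_orth_count (T : finType) (F : finFieldType) (n k : nat)
    (g : 'I_n -> 'I_k -> T -> F) (c : 'rV[F]_n) :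
  (\prod_j orth_count (g^~ j) c)%N
  = #|[set X : 'M[T]_(n, k) | c *m eval_mx g X == 0]|.
Proof.
pose P (j : 'I_k) : pred {ffun 'I_n -> T} :=
  [pred x : {ffun 'I_n -> T} | \sum_i c 0 i * g i j (x i) == 0].
transitivity #|(family P : pred {ffun 'I_k -> {ffun 'I_n -> T}})|.
  rewrite card_family_prod; apply: eq_bigr => j _.
  by apply: eq_card => x; rewrite !inE.
pose cols (X : 'M[T]_(n, k)) : {ffun 'I_k -> {ffun 'I_n -> T}} :=
  [ffun j => [ffun i => X i j]].
have cols_inj : injective cols.
  move=> X Y /ffunP eXY; apply/matrixP => i j.
  by have := eXY j; rewrite !ffunE => /ffunP/(_ i); rewrite !ffunE.
rewrite -(card_imset _ cols_inj); apply: eq_card => x.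
apply/familyP/imsetP => [xP|[X]].
  exists (\matrix_(i, j) x j i); last first.
    by apply/ffunP => j; apply/ffunP => i; rewrite !ffunE mxE.
  rewrite inE; apply/eqP/rowP => j; rewrite !mxE; have := xP j.
  rewrite inE => /eqP sum0; rewrite -[RHS]sum0.
  by apply: eq_bigr => i _; rewrite !mxE.
rewrite inE => /eqP/rowP cX -> j; rewrite inE; apply/eqP.
have := cX j; rewrite !mxE => sum0; rewrite -[RHS]sum0.
by apply: eq_bigr => i _; rewrite !mxE !ffunE.
Qed.

(** Double counting of the pairs of a vector [c] and a matrix [X] with [c *m eval_mx g X = 0]. *)
Lemma sum_prod_orth_count (T : finType) (F : finFieldType) (n k : nat)
    (g : 'I_n -> 'I_k -> T -> F) :
  (\sum_c \prod_j orth_count (g^~ j) c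
   = \sum_(X : 'M[T]_(n, k)) #|F| ^ (n - \rank (eval_mx g X)))%N.
Proof.
under eq_bigr do rewrite prod_orth_count -sum1_card.
under [RHS]eq_bigr do rewrite -card_left_kernel -sum1_card.
rewrite (exchange_big_dep predT) //=; apply: eq_bigr => X _.
by apply: eq_bigl => c; rewrite !inE.
Qed.

Lemma sum_by_rank (T : finType) (F : finFieldType) (n k : nat)
    (g : 'I_n -> 'I_k -> T -> F) (w : nat -> nat) :
  (\sum_(X : 'M[T]_(n, k)) w (\rank (eval_mx g X))
   = \sum_(s < k.+1)
       #|[set X : 'M[T]_(n, k) | \rank (eval_mx g X) == s]| * w s)%N.
Proof.
rewrite (partition_big (fun X : 'M[T]_(n, k) =>
  inord (\rank (eval_mx g X)) : 'I_k.+1) predT) //=.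
apply: eq_bigr => s _; rewrite -sum_nat_const.
have rs X : (inord (\rank (eval_mx g X)) == s) = (\rank (eval_mx g X) == s).
  by rewrite -val_eqE /= inordK // ltnS rank_leq_col.
apply: eq_big => [X|X]; first by rewrite inE rs.
by rewrite rs => /eqP->.
Qed.

Lemma orth_count0 (T : finType) (F : finFieldType) (n : nat)
    (h : 'I_n -> T -> F) :
  orth_count h 0 = (#|T| ^ n)%N.
Proof.
rewrite -[in RHS](card_ord n) -card_ffun -cardsT; apply: eq_card => x.
by rewrite !inE big1 ?eqxx // => i _; rewrite mxE mul0r.
Qed.

(** At a nonzero coordinate of [c], the value of [h] is solved for from the others. *)
Lemma orth_count_le (T : finType) (F : finFieldType) (n D : nat)
    (h : 'I_n -> T -> F) (c : 'rV[F]_n) :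
  (forall i a, #|[set t | h i t == a]| <= D)%N -> c != 0 ->
  (orth_count h c <= D * #|T| ^ n.-1)%N.
Proof.
move=> hD /rV0Pn[i ci]; have := @card_determined _ _ _ h D [set i].
move=> /(_ [set x : {ffun 'I_n -> T} | \sum_i c 0 i * h i (x i) == 0]).
rewrite cards1 cardsC1 card_ord expn1; apply=> // x y; rewrite !inE.
move=> /eqP xE /eqP yE exy _ /set1P->; apply: (mulfI ci).
move: xE yE; rewrite (bigD1 i) //= => xE; rewrite (bigD1 i) //=.
rewrite (eq_bigr (fun j => c 0 j * h j (x j))) => [yE|j ji].
  by apply: (addIr (\sum_(j < n | j != i) c 0 j * h j (x j))); rewrite xE yE.
by rewrite exy // !inE.
Qed.

(** * Comparison of a product with a power *)

(** One [M i] is replaced by [m] at a time. The weight [d] will be a further deviation in the next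
    lemma, so that [S] bounds products of two deviations; the factor [A] on the left avoids the
    exponent [n - 1]. *)
Lemma norm_prod_sub_expr (R : realFieldType) (n : nat) (M : 'I_n -> R)
    (m A S d : R) :
  0 <= m <= A -> (forall i, `|M i| <= A) ->
  (forall i, `|d * (M i - m)| <= S) ->
  A * `|d * (\prod_i M i - m ^+ n)| <= n%:R * A ^+ n * S.
Proof.
move=> /andP[m0 mA]; have A0 := le_trans m0 mA.
elim: n M => [|n IH] M MA dS.
  by rewrite big_ord0 expr0 subrr mulr0 normr0 mulr0 !mul0r.
rewrite big_ord_recr /=; set P := \prod_(i < n) _; set x := M ord_max.
have -> : d * (P * x - m ^+ n.+1) =
    x * (d * (P - m ^+ n)) + m ^+ n * (d * (x - m)) by rewrite exprS; ring.
apply: le_trans (ler_wpM2l A0 (ler_normD _ _)) _.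
have IHn := IH (fun i => M (widen_ord (leqnSn n) i)) (fun i => MA _) (fun i => dS _).
rewrite mulrDr -natr1 (_ : _ * S = A * (n%:R * A ^+ n * S) + A * (A ^+ n * S)).
  rewrite !(normrM x) !(normrM (m ^+ n)); apply: lerD.
    by rewrite mulrCA; apply: ler_pM (MA _) IHn => //; exact: mulr_ge0.
  apply: ler_wpM2l => //; apply: ler_pM (dS _) => //.
  by rewrite ger0_norm ?exprn_ge0 // lerXn2r // ?nnegrE.
by rewrite exprS; ring.
Qed.

(** Splitting off the last factor [x], the new remainder is [m] times the old one plus
    [(x - m) * (P - m ^+ n)], which the previous lemma bounds with [d = x - m]. *)
Lemma norm_prod_sub_linear (R : realFieldType) (n : nat) (M : 'I_n -> R)
    (m A S : R) :
  0 <= m <= A -> (forall i, `|M i| <= A) ->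
  (forall i j, `|(M i - m) * (M j - m)| <= S) ->
  A ^+ 2 * `|\prod_i M i - m ^+ n - m ^+ n.-1 * \sum_i (M i - m)|
    <= (n ^ 2)%:R * A ^+ n * S.
Proof.
move=> mA; have /andP[m0 lemA] := mA; have A0 := le_trans m0 lemA.
elim: n M => [|n IH] M MA dS.
  by rewrite big_ord0 big_ord0 expr0 subrr mulr0 subrr normr0 mulr0 !mul0r.
rewrite !big_ord_recr /=; set P := \prod_(i < n) _; set x := M ord_max.
set s := \sum_(i < n) _.
have -> : P * x - m ^+ n.+1 - m ^+ n * (s + (x - m)) =
    m * (P - m ^+ n - m ^+ n.-1 * s) + (x - m) * (P - m ^+ n).
  (* For [n = 0] the truncated [n.-1] is harmless, since [s] is then an empty sum. *)
  suff ms : m ^+ n * s = m * (m ^+ n.-1 * s) by rewrite mulrDr ms exprS; ring.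
  have [n0|n0] := posnP n; last by rewrite mulrA -exprS prednK.
  by rewrite /s big1 ?mulr0 // => -[i ltin]; exfalso; move: ltin; rewrite n0.
apply: le_trans (ler_wpM2l (exprn_ge0 _ A0) (ler_normD _ _)) _.
have IHn := IH (fun i => M (widen_ord (leqnSn n) i)) (fun i => MA _) (fun i j => dS _ _).
have IHd := @norm_prod_sub_expr R n (fun i => M (widen_ord (leqnSn n) i)) m A S
  (x - m) mA (fun i => MA _) (fun i => dS _ _).
have S0 : 0 <= S by apply: le_trans (dS ord_max ord_max).
apply: le_trans (_ : ((n ^ 2)%:R + n%:R) * (A ^+ n.+1 * S) <= _); last first.
  rewrite -mulrA ler_wpM2r ?mulr_ge0 ?exprn_ge0 // -natrD ler_nat.
  by rewrite !expnS !expn0; nia.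
rewrite (_ : (_ + _) * (A ^+ _ * S) = A * ((n ^ 2)%:R * A ^+ n * S) + A * (n%:R * A ^+ n * S)).
  rewrite mulrDr; apply: lerD.
    rewrite normrM (ger0_norm m0) mulrCA.
    by apply: ler_pM lemA IHn => //; rewrite mulr_ge0 ?exprn_ge0.
  by rewrite expr2 -mulrA; apply: ler_wpM2l.
by rewrite exprS; ring.
Qed.

(** * First and second moments of [orth_count] *)

Section OrthMoments.

Variables (T : finType) (F : finFieldType) (n D : nat) (h : 'I_n -> T -> F).
Hypothesis hD : forall i a, (#|[set t | h i t == a]| <= D)%N.

Local Notation q := #|F|.
Local Notation B := #|T|.

(** Double counting with a single column, of rank 0 or 1. Here [z] counts the columns that [h] sends
    to zero; it occurs on both sides to avoid subtraction in [nat]. *)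
Lemma sum_orth_count : (0 < n)%N ->
  exists2 z, (z <= D ^ n)%N &
    (\sum_c orth_count h c + z * q ^ n.-1 = B ^ n * q ^ n.-1 + z * q ^ n)%N.
Proof.
move=> n0; pose g (i : 'I_n) (j : 'I_1) := h i.
pose r s := #|[set X : 'M[T]_(n, 1) | \rank (eval_mx g X) == s]|.
exists (r 0).
  have := @card_rank T F n 1 0 D g (fun i _ => hD i).
  by rewrite !expn0 !subn0 !muln1 subnn expn0 mul1n muln1.
have := sum_prod_orth_count g; under eq_bigr do rewrite big_ord1.
rewrite (sum_by_rank g (fun s => q ^ (n - s))%N) !big_ord_recr big_ord0 /=.
rewrite add0n subn0 subn1 -!/(r _) => ->.
have : (r 0 + r 1)%N = (B ^ n)%N.
  have := sum_by_rank g (fun=> 1%N); rewrite sum1_card card_mx muln1 => ->.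
  by rewrite !big_ord_recr big_ord0 /= !muln1.
by move=> <-; rewrite mulnDl addnC addnA addnAC.
Qed.

(** Double counting with two columns; the three terms come from ranks 2, 1 and 0. Rank 1 means
    proportional columns, where [n.-1] entries are determined by the other [n.+1]. *)
Lemma sum_orth_count_sqr : (1 < n)%N ->
  (\sum_c orth_count h c ^ 2 <= B ^ (n * 2) * q ^ n.-2
    + 2 * n * D ^ n.-1 * B ^ n.+1 * q ^ n.-1 + D ^ (n * 2) * q ^ n)%N.
Proof.
move=> n1; pose g (i : 'I_n) (j : 'I_2) := h i.
pose r s := #|[set X : 'M[T]_(n, 2) | \rank (eval_mx g X) == s]|.
have := sum_prod_orth_count g; under eq_bigr do rewrite big_ord_recl big_ord1.
rewrite (sum_by_rank g (fun s => q ^ (n - s))%N) !big_ord_recr big_ord0 /=.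
rewrite add0n subn0 subn1 subn2 -!/(r _) => eqs.
under eq_bigr do rewrite -mulnn; rewrite eqs.
have r0 : (r 0 <= D ^ (n * 2))%N.
  have := @card_rank T F n 2 0 D g (fun i _ => hD i).
  by rewrite !expn0 !subn0 subnn expn0 !mul1n muln1.
have r1 : (r 1 <= 2 * n * D ^ n.-1 * B ^ n.+1)%N.
  have := @card_rank T F n 2 1 D g (fun i _ => hD i).
  rewrite !expn1 !subn1 muln1 mulnA [(n * 2)%N]mulnC.
  by rewrite (_ : 2 * n - n.-1 = n.+1)%N //; lia.
have r2 : (r 2 <= B ^ (n * 2))%N.
  by rewrite -card_mx; exact: max_card.
rewrite addnC [(r 0 * _ + _)%N]addnC addnA.
by rewrite !leq_add ?leq_mul.
Qed.

(** Expand about [mu]. The first moment is at least [mu * q ^ n], so the cross term cancels the rank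
    2 term and the square of [mu]. The bound on [q] absorbs the rank 0 term. *)
Lemma variance_orth_count (R : realFieldType) : (1 < n)%N -> (q <= B ^ n.+1)%N ->
  \sum_c ((orth_count h c)%:R - B%:R ^+ n / q%:R) ^+ 2
    <= (2 * n * D ^ n.-1 + D ^ (n * 2))%:R * (q%:R ^+ n.-1 * B%:R ^+ n.+1) :> R.
Proof.
move=> n1 qB; have q0 : (0 : R) < q%:R.
  by rewrite ltr0n; apply: (ltn_trans _ (card_finNzRing_gt1 F)).
have [z zD s1] := sum_orth_count (ltnW n1).
set b : R := B%:R; set Q : R := q%:R; set mu := b ^+ n / Q.
have e1 : \sum_c (orth_count h c)%:R + z%:R * Q ^+ n.-1
    = b ^+ n * Q ^+ n.-1 + z%:R * Q ^+ n.
  by rewrite -natr_sum -!natrX -!natrM -!natrD s1.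
have e2 : \sum_c (orth_count h c)%:R ^+ 2 <= b ^+ (n * 2) * Q ^+ n.-2
    + (2 * n * D ^ n.-1)%:R * b ^+ n.+1 * Q ^+ n.-1
    + (D ^ (n * 2))%:R * Q ^+ n.
  under eq_bigr do rewrite -natrX.
  by rewrite -natr_sum -!natrX -!natrM -!natrD ler_nat sum_orth_count_sqr.
rewrite (eq_bigr (fun c => (orth_count h c)%:R ^+ 2 - 2 * mu * (orth_count h c)%:R
    + mu ^+ 2)); last by move=> c _; ring.
rewrite big_split big_split /= sumrN -mulr_sumr sumr_const card_mx mul1n.
rewrite -[mu ^+ 2 *+ _]mulr_natr natrX.
rewrite natrD; move: e1 e2; set t1 := \sum_c _; set t2 := \sum_c _ => e1 e2.
move: (2 * n * D ^ n.-1)%N (D ^ (n * 2))%N e2 => d1 d2 e2.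
have b0 : 0 <= b by rewrite ler0n.
have mu0 : 0 <= mu by rewrite divr_ge0 ?exprn_ge0 // ltW.
have defb : b ^+ n = mu * Q by rewrite /mu divfK // gt_eqF.
have Qb : Q <= b ^+ n.+1 by rewrite -natrX ler_nat.
have Q1 : 1 <= Q by rewrite ler1n; apply: ltnW; exact: card_finNzRing_gt1.
have Qn1 : Q ^+ n.-1 = Q * Q ^+ n.-2 by rewrite -exprS; congr (_ ^+ _); lia.
have Qn : Q ^+ n = Q * (Q * Q ^+ n.-2) by rewrite -!exprS; congr (_ ^+ _); lia.
have y0 : 0 <= Q ^+ n.-2 by rewrite exprn_ge0 // ltW.
move: e1 e2; rewrite exprM defb Qn1 -/Q Qn.
move: (Q ^+ n.-2) (b ^+ n.+1) y0 Qb => y w y0 Qw e1 e2.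
have z0 : 0 <= z%:R * ((Q - 1) * (Q * y)).
  by rewrite !mulr_ge0 // ?subr_ge0 // ltW.
have h3 : 0 <= d2%:R * (Q * y * (w - Q)).
  by rewrite !mulr_ge0 // ?subr_ge0 // ltW.
have h4 : 0 <= mu * (t1 - mu * (Q * (Q * y))).
  by rewrite mulr_ge0 // subr_ge0; lra.
lra.
Qed.

End OrthMoments.

(** * Singular matrices sorted by corank *)

Section DetZero.

Variables (T : finType) (F : finFieldType) (n D : nat).
Variable g : 'I_n -> 'I_n -> T -> F.
Hypothesis gD : forall i j a, (#|[set t | g i j t == a]| <= D)%N.
Hypotheses (n_gt0 : (0 < n)%N) (D_gt0 : (0 < D)%N) (T_gt0 : (0 < #|T|)%N).

Local Notation q := #|F|.
Local Notation B := #|T|.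
Let r s := #|[set X : 'M[T]_n | \rank (eval_mx g X) == s]|.
Let N := #|[set X : 'M[T]_n | \det (eval_mx g X) == 0]|.

Lemma card_rank_square s : (s < n)%N ->
  (r s <= n ^ (2 * n) * D ^ (n * n) * B ^ (n * n - (n - s) * (n - s)))%N.
Proof.
move=> sn; apply: leq_trans (card_rank s gD) _; rewrite mulnA leq_mul2r.
apply/orP; right; rewrite -expnD leq_mul // leq_pexp2l //; first lia.
by apply: leq_mul; apply: leq_subr.
Qed.

Lemma card_det0_rank : N = (\sum_(s < n) r s)%N.
Proof.
have := sum_by_rank g (fun=> 1%N); rewrite sum1_card big_ord_recr /=.
rewrite card_mx -card_mx -(cardsC [set X | \det (eval_mx g X) == 0]) !muln1.
under eq_bigr do rewrite muln1.
rewrite -!/(r _) -/N (_ : #|~: _| = r n) => [/addIn //|].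
apply: eq_card => X; rewrite !inE -/(row_free _) row_free_unit unitmxE.
by rewrite unitfE.
Qed.

(** Corank at least 1 leaves at most [n * n - 1] free entries. This serves the boxes of side below
    the square root of [q]. *)
Lemma card_det0_le :
  (N <= n * (n ^ (2 * n) * D ^ (n * n)) * B ^ (n * n - 1))%N.
Proof.
rewrite card_det0_rank -mulnA -[X in (X * _)%N]card_ord -sum_nat_const.
apply: leq_sum => s _; apply: leq_trans (card_rank_square (ltn_ord s)) _.
rewrite leq_mul2l leq_pexp2l ?orbT //; have := ltn_ord s; nia.
Qed.

(* A matrix of corank r is counted (q ^ r - 1) times by its nonzero left kernel
   vectors, i.e. with an excess of q ^ r - q over (q - 1) times. *)
Lemma sum_nz_prod_orth_count (R : realFieldType) :
  \sum_(c : 'rV[F]_n | c != 0) \prod_j (orth_count (g^~ j) c)%:R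
  = (q%:R - 1) * N%:R + \sum_(s < n) (r s)%:R * (q%:R ^+ (n - s) - q%:R) :> R.
Proof.
have tot : \sum_(c : 'rV[F]_n) \prod_j (orth_count (g^~ j) c)%:R
    = \sum_(s < n.+1) (r s)%:R * q%:R ^+ (n - s) :> R.
  under eq_bigr do rewrite -natr_prod.
  rewrite -natr_sum sum_prod_orth_count.
  rewrite (sum_by_rank g (fun s => q ^ (n - s))%N) natr_sum.
  by apply: eq_bigr => s _; rewrite natrM natrX.
have all : \prod_j (orth_count (g^~ j) 0)%:R = \sum_(s < n.+1) (r s)%:R :> R.
  under eq_bigr do rewrite orth_count0.
  rewrite -natr_prod prod_nat_const card_ord -expnM -card_mx -sum1_card.
  rewrite (sum_by_rank g (fun=> 1%N)) natr_sum.
  by apply: eq_bigr => s _; rewrite muln1.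
move: tot; rewrite (bigD1 0) //= all !big_ord_recr /= subnn expr0 mulr1.
rewrite card_det0_rank natr_sum mulr_sumr -big_split /=.
set S1 := \sum_(s < n) _; set S2 := \sum_(c | _) _; set S3 := \sum_(s < n) _.
move=> tot; have -> : S2 = S3 - S1 by lra.
by rewrite -sumrB; apply: eq_bigr => s _; ring.
Qed.

End DetZero.

(** * Asymptotics for boxes of side at least the square root of [q] *)

(** Here [s] stands for the square root of [q] and [k] for the corank. Three factors [s] are kept
    and the other [2k - 3] are replaced by [b]; then [n^2 - k^2 + 2k - 3 = n^2 - 2 - (k - 1)^2]. *)
Lemma corank_weight_le (R : realFieldType) (n k : nat) (s b : R) :
  1 <= s <= b -> (1 < k <= n)%N ->
  b ^+ (n * n - k * k) * (s ^+ 2) ^+ k <= s ^+ 2 * s * b ^+ (n * n - 2).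
Proof.
move=> /andP[s1 sb] /andP[k1 kn].
have s0 : 0 <= s by apply: le_trans s1.
have b1 : 1 <= b by apply: le_trans sb.
have -> : (s ^+ 2) ^+ k = s ^+ 2 * s * s ^+ (2 * k - 3).
  by rewrite -exprM -exprSr -exprD; congr (_ ^+ _); lia.
rewrite mulrCA ler_wpM2l ?mulr_ge0 ?exprn_ge0 //.
apply: le_trans (_ : b ^+ (n * n - k * k) * b ^+ (2 * k - 3) <= _).
  by rewrite ler_wpM2l ?exprn_ge0 ?(le_trans s0) // lerXn2r ?nnegrE ?(le_trans s0).
by rewrite -exprD ler_weXn2l //; nia.
Qed.

Lemma ler_sum_ord_const (R : realFieldType) (n : nat) (x : R) (f : 'I_n -> R) :
  (forall i, f i <= x) -> \sum_i f i <= n%:R * x.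
Proof.
move=> fx; rewrite mulr_natl -[X in x *+ X]card_ord -sumr_const.
by apply: ler_sum => i _; exact: fx.
Qed.

Section DetZeroAsymptotics.

Variables (R : realFieldType) (T : finType) (F : finFieldType) (n D : nat).
Variables (g : 'I_n -> 'I_n -> T -> F) (s : R).
Hypothesis gD : forall i j a, (#|[set t | g i j t == a]| <= D)%N.
Hypotheses (n_ge3 : (3 <= n)%N) (D_gt0 : (0 < D)%N) (TF : (#|T| <= #|F|)%N).

Local Notation q := (#|F|%:R : R).
Local Notation b := (#|T|%:R : R).

Hypotheses (s_bnd : 1 <= s <= b) (s_sqr : s ^+ 2 = q).

Let M j (c : 'rV[F]_n) : R := (orth_count (g^~ j) c)%:R.
Let m : R := b ^+ n / q.
(** [q] times the target error, since the double count gives [(q - 1) * N] rather than [N]. *)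
Let E : R := q * (s * b ^+ (n * n - 2)).

Let n_gt0 : (0 < n)%N. Proof. exact: ltn_trans n_ge3. Qed.
Let s_ge1 : 1 <= s. Proof. by case/andP: s_bnd. Qed.
Let b_ge1 : 1 <= b. Proof. by case/andP: s_bnd => s1; apply: le_trans. Qed.
Let q_ge1 : 1 <= q. Proof. by rewrite -s_sqr exprn_ege1. Qed.
Let q_gt0 : 0 < q. Proof. exact: lt_le_trans q_ge1. Qed.
Let b_gt0 : 0 < b. Proof. exact: lt_le_trans b_ge1. Qed.
Let s_gt0 : 0 < s. Proof. exact: lt_le_trans s_ge1. Qed.
Let b_le_q : b <= q. Proof. by rewrite ler_nat. Qed.
Let b_mul_m : b ^+ n = m * q. Proof. by rewrite /m divfK // gt_eqF. Qed.
Let m_ge0 : 0 <= m. Proof. by rewrite divr_ge0 ?exprn_ge0 // ltW. Qed.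

(** Corank 1 has weight [q - q = 0]; larger coranks fall under [corank_weight_le]. *)
Lemma corank_excess_le :
  0 <= \sum_(k < n) (#|[set X : 'M[T]_n | \rank (eval_mx g X) == k]|)%:R
         * (q ^+ (n - k) - q)
    <= (n * (n ^ (2 * n) * D ^ (n * n)))%:R * E.
Proof.
have le_q k : (k < n)%N -> q <= q ^+ (n - k).
  by move=> kn; rewrite -[X in X <= _]expr1 ler_weXn2l // subn_gt0.
apply/andP; split.
  by apply: sumr_ge0 => k _; rewrite mulr_ge0 // subr_ge0 le_q.
rewrite natrM -mulrA; apply: ler_sum_ord_const => k.
have E0 : 0 <= E by rewrite !mulr_ge0 ?exprn_ge0 // ltW.
have [k1|k1] := eqVneq (n - k)%N 1%N; first by rewrite k1 expr1 subrr mulr0 mulr_ge0.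
apply: le_trans (_ : (n ^ (2 * n) * D ^ (n * n))%:R * b ^+ (n * n - (n - k) * (n - k))
                     * q ^+ (n - k) <= _).
  rewrite ler_pM // ?subr_ge0 ?le_q //; last by rewrite gerBl ltW.
  rewrite -natrX -natrM ler_nat; apply: card_rank_square => //.
  by rewrite -(ltr0n R).
rewrite -mulrA ler_wpM2l // /E mulrA -s_sqr corank_weight_le //.
by rewrite ltn_neqAle eq_sym k1 subn_gt0 ltn_ord leq_subr.
Qed.

(** By the first moment, the deviations of each [M j] sum to [O(q ^ n)], also after removing
    [c = 0]. Multiplied by [m ^+ n.-1] this is [O(q * b ^ (n * n.-1))], and
    [n * n.-1 <= n * n - 2]. *)
Lemma sum_nz_deviation_le :
  `|m ^+ n.-1 * \sum_j \sum_(c | c != 0) (M j c - m)|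
    <= (n * (D ^ n + 1))%:R * E.
Proof.
have dev j : `|\sum_(c | c != 0) (M j c - m)| <= (D ^ n + 1)%:R * q ^+ n.
  have [z zD sumM] := sum_orth_count (gD^~ j) n_gt0.
  have {}sumM : \sum_c (M j c - m) = z%:R * (q ^+ n - q ^+ n.-1).
    rewrite sumrB -natr_sum sumr_const card_mx mul1n -[m *+ _]mulr_natr natrX.
    move/(congr1 (fun k => k%:R : R)): sumM; rewrite !natrD !natrM !natrX b_mul_m.
    have -> : q ^+ n = q * q ^+ n.-1 by rewrite -exprS prednK.
    by move=> sumM; lra.
  have M0 : M j 0 = b ^+ n by rewrite /M orth_count0 natrX.
  move: sumM; rewrite (bigD1 0) //= M0 => sumM.
  have -> : \sum_(c | c != 0) (M j c - m)
      = z%:R * (q ^+ n - q ^+ n.-1) - (b ^+ n - m) by rewrite -sumM; ring.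
  have qq : q ^+ n.-1 <= q ^+ n by rewrite ler_weXn2l // leq_pred.
  have bq : b ^+ n <= q ^+ n by rewrite lerXn2r ?nnegrE // ltW.
  have mb : m <= b ^+ n by rewrite b_mul_m ler_peMr.
  have q0 : 0 <= q ^+ n.-1 by rewrite exprn_ge0 // ltW.
  have zD' : z%:R <= (D ^ n)%:R :> R by rewrite ler_nat.
  apply: le_trans (ler_normB _ _) _.
  rewrite natrD mulrDl mul1r; apply: lerD.
    by rewrite ger0_norm ?mulr_ge0 ?subr_ge0 // ler_pM // ?subr_ge0 // gerBl.
  by rewrite ger0_norm ?subr_ge0 // lerBlDr (le_trans bq) // lerDl.
rewrite normrM ger0_norm ?exprn_ge0 //.
apply: le_trans (_ : m ^+ n.-1 * (n%:R * ((D ^ n + 1)%:R * q ^+ n)) <= _).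
  rewrite ler_wpM2l ?exprn_ge0 //; apply: le_trans (ler_norm_sum _ _ _) _.
  exact: ler_sum_ord_const.
rewrite natrM -!mulrA mulrCA ler_wpM2l // mulrCA ler_wpM2l //.
have -> : m ^+ n.-1 * q ^+ n = q * b ^+ (n * n.-1).
  by rewrite exprM b_mul_m [(m * q) ^+ _]exprMn mulrCA -exprS prednK.
rewrite ler_wpM2l ?(ltW q_gt0) //.
apply: le_trans (_ : b ^+ (n * n - 2) <= _); first by rewrite ler_weXn2l //; (clear - n_ge3; nia).
by rewrite ler_peMl // exprn_ge0 // ltW.
Qed.

(** At each nonzero [c] the remainder is at most a constant times [A ^+ (n - 2)] times the sum of
    the squared deviations, which the variance bound controls after summing over [c]. *)
Lemma sum_nz_quadratic_le :
  `|\sum_(c | c != 0) (\prod_j M j c - m ^+ n - m ^+ n.-1 * \sum_j (M j c - m))|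
    <= (n ^ 2 * D ^ (n - 2) * (n * (2 * n * D ^ n.-1 + D ^ (n * 2))))%:R * E.
Proof.
(* [A] bounds both [M j c] at nonzero [c] and [m], the latter because [b <= q]. *)
pose A : R := D%:R * b ^+ n.-1.
have A0 : 0 < A by rewrite mulr_gt0 ?exprn_gt0 // ltr0n.
have mA : 0 <= m <= A.
  rewrite m_ge0 /= /m ler_pdivrMr // /A.
  have -> : b ^+ n = b * b ^+ n.-1 by rewrite -exprS prednK.
  have bn0 : 0 <= b ^+ n.-1 by rewrite exprn_ge0 // ltW.
  apply: le_trans (ler_wpM2r bn0 b_le_q) _.
  by rewrite -mulrA [_ * q]mulrC ler_peMl ?ler1n // mulr_ge0 // ltW.
pose W := (2 * n * D ^ n.-1 + D ^ (n * 2))%N.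
have var j : \sum_c (M j c - m) ^+ 2 <= W%:R * (q ^+ n.-1 * b ^+ n.+1).
  apply: variance_orth_count => [i||]; [exact: gD|(clear - n_ge3; lia)|].
  rewrite -(ler_nat R) natrX -s_sqr.
  apply: le_trans (_ : b ^+ 2 <= _); last by rewrite ler_weXn2l //; (clear - n_ge3; lia).
  by rewrite lerXn2r ?nnegrE ?(ltW s_gt0) ?(ltW b_gt0) //; case/andP: s_bnd.
have pointwise c : c != 0 ->
    `|\prod_j M j c - m ^+ n - m ^+ n.-1 * \sum_j (M j c - m)|
    <= (n ^ 2)%:R * A ^+ (n - 2) * \sum_j (M j c - m) ^+ 2.
  move=> c0; rewrite -(ler_pM2l (exprn_gt0 2 A0)).
  have -> : A ^+ 2 * ((n ^ 2)%:R * A ^+ (n - 2) * \sum_j (M j c - m) ^+ 2)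
      = (n ^ 2)%:R * A ^+ n * \sum_j (M j c - m) ^+ 2.
    have -> : A ^+ n = A ^+ 2 * A ^+ (n - 2) by rewrite -exprD subnKC // ltnW.
    by ring.
  apply: norm_prod_sub_linear => // [j|i j].
    rewrite ger0_norm /M ?ler0n // /A -natrX -natrM ler_nat.
    by apply: orth_count_le => // i; exact: gD.
  have sq k : (M k c - m) ^+ 2 <= \sum_j (M j c - m) ^+ 2.
    by rewrite (bigD1 k) //= lerDl sumr_ge0 // => l _; rewrite sqr_ge0.
  have := sq i; have := sq j; move: (M i c - m) (M j c - m) => x y.
  have := sqr_ge0 (x - y); have := sqr_ge0 (x + y); rewrite !expr2.
  by move=> ????; rewrite ler_norml; apply/andP; split; lra.
apply: le_trans (ler_norm_sum _ _ _) _.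
apply: le_trans (_ : \sum_(c | c != 0) (n ^ 2)%:R * A ^+ (n - 2) *
                       \sum_j (M j c - m) ^+ 2 <= _).
  by apply: ler_sum => c; exact: pointwise.
rewrite -mulr_sumr.
apply: le_trans (_ : (n ^ 2)%:R * A ^+ (n - 2) *
                     (n%:R * (W%:R * (q ^+ n.-1 * b ^+ n.+1))) <= _).
  rewrite ler_wpM2l ?mulr_ge0 ?exprn_ge0 // ?(ltW A0) //.
  rewrite exchange_big /=; apply: ler_sum_ord_const => j.
  apply: le_trans (var j).
  by rewrite [X in _ <= X](bigD1 0) //= lerDr sqr_ge0.
rewrite !natrM /A exprMn -exprM natrX.
have -> x1 x2 x3 x4 x5 x6 x7 : x1 * (x2 * x3) * (x4 * (x5 * (x6 * x7)))
    = x1 * x2 * (x4 * x5) * (x6 * (x3 * x7)) :> R by ring.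
rewrite ler_wpM2l ?mulr_ge0 ?exprn_ge0 //.
(* Three of the [2n - 2] factors [s] go into [E], the other [2n - 5] are replaced by [b]. The
   exponents [2n - 5], [(n - 1)(n - 2)] and [n + 1] add up to exactly [n^2 - 2]. *)
have -> : q ^+ n.-1 = q * (s * s ^+ (2 * n - 5)).
  by rewrite -s_sqr -exprM -exprS -exprD; congr (_ ^+ _); (clear - n_ge3; lia).
rewrite -mulrA ler_wpM2l ?(ltW q_gt0) // -mulrA ler_wpM2l ?(ltW s_gt0) //.
apply: le_trans (_ : b ^+ (2 * n - 5) * (b ^+ (n.-1 * (n - 2)) * b ^+ n.+1) <= _).
  rewrite ler_wpM2r ?mulr_ge0 ?exprn_ge0 // ?(ltW b_gt0) //.
  by rewrite lerXn2r ?nnegrE ?(ltW s_gt0) ?(ltW b_gt0) //; case/andP: s_bnd.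
by rewrite -!exprD ler_weXn2l //; (clear - n_ge3; nia).
Qed.

(** The constant terms [m ^+ n] over the [q ^ n - 1] nonzero vectors miss the expected value by at
    most [b ^ (n * n) / q], and [b <= q] turns this into [q * b ^ (n * n - 2)]. *)
Lemma det0_main_term_le :
  `|(q ^+ n - 1) * m ^+ n - (q - 1) * (b ^+ (n * n) / q)| <= E.
Proof.
have qn0 : 0 < q ^+ n by rewrite exprn_gt0.
have bn0 : 0 <= b ^+ (n * n) by rewrite exprn_ge0 // ltW.
have -> : (q ^+ n - 1) * m ^+ n - (q - 1) * (b ^+ (n * n) / q)
    = b ^+ (n * n) * (q^-1 - (q ^+ n)^-1).
  rewrite /m expr_div_n -exprM; field; by rewrite !gt_eqF.
have qle : (q ^+ n)^-1 <= q^-1.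
  by rewrite lef_pV2 ?posrE // -[X in X <= _]expr1 ler_weXn2l.
rewrite ger0_norm ?mulr_ge0 ?subr_ge0 //.
apply: le_trans (_ : b ^+ (n * n) / q <= _).
  by rewrite ler_wpM2l // gerBl invr_ge0 ltW.
rewrite ler_pdivrMr //.
have -> : b ^+ (n * n) = b ^+ 2 * b ^+ (n * n - 2).
  by rewrite -exprD subnKC //; (clear - n_ge3; nia).
have -> : E * q = s * (q ^+ 2 * b ^+ (n * n - 2)) by rewrite /E; ring.
apply: le_trans (_ : q ^+ 2 * b ^+ (n * n - 2) <= _).
  by rewrite ler_wpM2r ?exprn_ge0 ?(ltW b_gt0) // lerXn2r ?nnegrE // ltW.
by rewrite ler_peMl // mulr_ge0 ?exprn_ge0 // ltW.
Qed.

(** The summands are the constants of the quadratic, linear, excess and main term bounds, in this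
    order. *)
Definition det0_const : nat :=
  n ^ 2 * D ^ (n - 2) * (n * (2 * n * D ^ n.-1 + D ^ (n * 2)))
  + n * (D ^ n + 1) + n * (n ^ (2 * n) * D ^ (n * n)) + 1.

Lemma card_det0_asymptotics :
  `|(#|[set X : 'M[T]_n | \det (eval_mx g X) == 0]|)%:R - b ^+ (n * n) / q|
    <= (2 * det0_const)%:R * (s * b ^+ (n * n - 2)).
Proof.
set N := #|_|.
(* Hence [q <= 2 * (q - 1)], the origin of the factor 2 in the statement. *)
have q2 : 2 <= q by rewrite ler_nat; exact: card_finNzRing_gt1.
rewrite -(@ler_pM2l _ (q - 1)) ?subr_gt0; last by lra.
apply: le_trans (_ : det0_const%:R * E <= _); last first.
  have x0 : 0 <= det0_const%:R * (s * b ^+ (n * n - 2)).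
    by rewrite !mulr_ge0 ?exprn_ge0 // ltW.
  rewrite /E natrM; nra.
rewrite -[X in X * `|_|]ger0_norm ?subr_ge0 // -normrM.
have := sum_nz_prod_orth_count g R; rewrite -/N.
have := corank_excess_le; set X := \sum_(k < n) _ => /andP[X0 X1] defN.
have := sum_nz_quadratic_le; rewrite !sumrB sumr_const -mulr_sumr.
rewrite [\sum_(c | c != 0) \sum_j (M j c - m)]exchange_big /=.
rewrite [\sum_(c | _) _]defN.
rewrite (_ : m ^+ n *+ _ = (q ^+ n - 1) * m ^+ n); last first.
  rewrite -mulr_natl; congr (_ * _); apply/eqP; rewrite eq_sym subr_eq natr1.
  rewrite -natrX -[n in (_ ^ n)%N]mul1n -card_mx (cardD1 0) inE add1n.
  by apply/eqP; congr (_.+1%:R); apply: eq_card => c; rewrite !inE andbT.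
have := sum_nz_deviation_le; set L := m ^+ n.-1 * _ => Lle.
have := det0_main_term_le; set Z := _ - _ => Zle quad.
have -> : (q - 1) * (N%:R - b ^+ (n * n) / q)
  = ((q - 1) * N%:R + X - (q ^+ n - 1) * m ^+ n - L) + L + Z - X by rewrite /Z; ring.
have bnd := lerD (lerD (lerD quad Lle) Zle) X1.
apply: le_trans (_ : _ <= _) (le_trans bnd _); last first.
  by rewrite /det0_const !natrD !mulrDl mul1r [X in _ <= X]addrAC.
apply: le_trans (ler_normB _ _) _; rewrite (ger0_norm X0) lerD2r.
apply: le_trans (ler_normD _ _) _; rewrite lerD2r.
exact: ler_normD.
Qed.

End DetZeroAsymptotics.

(** * Reduction modulo [p] and the two ranges of [H] *)

(** The integers of the box are distinct modulo [p], and [f - a] keeps the positive degree of [f]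
    there, so it has fewer than [size f] roots. *)
Lemma card_box_fiber (p H : nat) (f : {poly int}) (a : 'F_p) :
  prime p -> (2 * H + 1 <= p)%N -> (1 < size f)%N ->
  ~~ (p%:Z %| lead_coef f)%Z ->
  (#|[set k : 'I_(2 * H + 1) | (f.[box_val k])%:~R == a]| <= size f)%N.
Proof.
move=> pp Hp sf lcf; set S := [set k | _].
pose x (k : 'I_(2 * H + 1)) : 'F_p := (box_val k)%:~R.
pose P := map_poly intr f - a%:P.
have sizeP : size P = size f.
  have sm : size (map_poly intr f : {poly 'F_p}) = size f.
    by rewrite size_map_poly_id0 // -(dvdz_pcharf (pchar_Fp pp)).
  by rewrite size_polyDl sm // size_polyN (leq_ltn_trans (size_polyC_leq1 _)).
have P0 : P != 0 by rewrite -size_poly_gt0 sizeP ltnW.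
have injx : injective x.
  move=> k l; rewrite /x /box_val !intrB => /addIr /eqP.
  rewrite -!pmulrn => /eqP/(congr1 val); rewrite /= !val_Fp_nat // => kl.
  by apply: val_inj; move: kl; rewrite !modn_small // (leq_trans (ltn_ord _)).
have := @max_poly_roots _ P (map x (enum S)) P0.
rewrite map_inj_uniq ?enum_uniq // size_map -cardE sizeP => lt.
apply/ltnW/lt => //; apply/allP => _ /mapP[k kS ->].
move: kS; rewrite mem_enum inE => /eqP fa.
by rewrite rootE !hornerE horner_map /= fa subrr.
Qed.

Lemma det_countE (n p H : nat) (f : 'M[{poly int}]_n) : prime p ->
  det_count f H p = #|[set X : 'M['I_(2 * H + 1)]_n |
    \det (eval_mx (fun i j k => ((f i j).[box_val k])%:~R : 'F_p) X) == 0]|.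
Proof.
move=> pp; apply: eq_card => X; rewrite !inE (dvdz_pcharf (pchar_Fp pp)).
rewrite -det_map_mx; congr (\det _ == 0).
by apply/matrixP => i j; rewrite !mxE.
Qed.

Local Open Scope classical_set_scope.

Theorem theorem2p8 (R : realType) (n : nat) (hn : (3 <= n)%N)
    (f : 'M[{poly int}]_n)
    (hf : forall i j : 'I_n, (1 < size (f i j))%N) :
  exists (C : R) (p0 : nat) (o1 o2 : nat -> R),
    [/\ o1 k @[k --> \oo] --> (0 : R),
        o2 k @[k --> \oo] --> (0 : R)
      & forall p H : nat, prime p -> (p0 <= p)%N ->
          (0 < H)%N -> (H%:R : R) <= p%:R / 2 ->
          `| (det_count f H p)%:R - p%:R^-1 * (2 * H%:R + 1) ^+ (n ^ 2)%N |
          <= C * (p%:R `^ ((n%:R ^+ 2 - 1) / 2 + o1 p)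
                  + H%:R ^+ (n ^ 2 - 2)%N * p%:R `^ (1 / 2 + o2 p)) ].
Proof.
have n0 : (0 < n)%N by apply: ltn_trans hn.
pose D := (\sum_i \sum_j size (f i j)).+1.
pose K := (2 * det0_const n D)%N.
pose K' := (n * (n ^ (2 * n) * D ^ (n * n)))%N.
(* [K] serves the range of large [H], where [2H + 1 <= 3H] costs the power of 3; [K' + 1] serves
   small [H], the 1 being for the main term. *)
pose C := (K * 3 ^ (n * n - 2) + K' + 1)%N.
(* The threshold exceeds all leading coefficients in absolute value, so no [f i j] loses degree
   modulo [p], and it makes [p] odd. *)
exists C%:R, (\sum_i \sum_j `|lead_coef (f i j)|).+3, (fun=> 0), (fun=> 0).
split; [exact: cvg_cst|exact: cvg_cst|] => p H pp lep H0 leH.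
have le_sum2 (w : 'I_n -> 'I_n -> nat) i j : (w i j <= \sum_i \sum_j w i j)%N.
  by rewrite (bigD1 i) //= (bigD1 j) //= -addnA leq_addr.
have p3 : (2 < p)%N by apply: leq_trans lep.
(* The hypothesis gives [2 * H <= p], and equality fails because [p] is odd. *)
have HB : (2 * H + 1 <= p)%N.
  have : (2 * H <= p)%N by rewrite -(ler_nat R) natrM; lra.
  rewrite leq_eqVlt addn1 => /orP[/eqP e2|//].
  have [p2|] := even_prime pp; first by rewrite p2 in p3.
  by rewrite -e2 oddM.
pose g i j (k : 'I_(2 * H + 1)) : 'F_p := ((f i j).[box_val k])%:~R.
have gD i j a : (#|[set k | g i j k == a]%SET| <= D)%N.
  have lc : ~~ (p%:Z %| lead_coef (f i j))%Z.
    apply/negP => /dvdn_leq; rewrite absz_gt0 lead_coef_eq0 -size_poly_gt0.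
    move=> /(_ (ltnW (hf i j))); apply/negP; rewrite -ltnNge.
    have := le_sum2 (fun i j => `|lead_coef (f i j)|%N) i j.
    by move=> /leq_ltn_trans; apply; apply: leq_trans lep; rewrite ltnS leqW.
  apply: (@leq_trans (size (f i j))); first exact: card_box_fiber.
  by apply: leqW; exact: (le_sum2 (fun i j => size (f i j))).
have cF : #|'F_p| = p by rewrite card_Fp.
have cT : #|'I_(2 * H + 1)| = (2 * H + 1)%N by rewrite card_ord.
pose s : R := p%:R `^ (1 / 2); pose b : R := (2 * H + 1)%:R.
have s2 : s ^+ 2 = p%:R.
  by rewrite -powR_mulrn ?powR_ge0 // -powRrM mul1r mulVf // powRr1.
have s1 : 1 <= s.
  by rewrite -(@ler_pXn2r _ 2) ?nnegrE ?powR_ge0 // expr1n s2 ler1n prime_gt0.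
have s0 : 0 <= s by apply: le_trans s1.
have b0 : 0 <= b by [].
have bE : 2 * H%:R + 1 = b by rewrite /b natrD natrM.
have b3 : b <= 3 * H%:R by rewrite -natrM ler_nat; lia.
rewrite !addr0 bE -mulnn det_countE //.
have -> : p%:R `^ ((n%:R ^+ 2 - 1) / 2) = s ^+ (n * n - 1).
  rewrite -powR_mulrn // -powRrM natrB ?muln_gt0 ?n0 // natrM.
  by congr (_ `^ _); field.
rewrite -/s [p%:R^-1 * _]mulrC; set N := #|_|.
have N0 : 0 <= H%:R ^+ (n * n - 2) * s by rewrite mulr_ge0 ?exprn_ge0.
have M0 : 0 <= s ^+ (n * n - 1) by rewrite exprn_ge0.
(* For [s <= b] the second error term suffices; for [b < s] the count and the main term are each
   within the first. *)
have [sb|bs] := leP s b.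
  have := @card_det0_asymptotics R _ _ n D g s gD hn isT.
  rewrite cF cT -/N -/b -/K s1 sb => /(_ HB isT s2) => le1.
  apply: le_trans le1 _.
  apply: le_trans (_ : (K * 3 ^ (n * n - 2))%:R * (H%:R ^+ (n * n - 2) * s) <= _).
    rewrite natrM -mulrA ler_wpM2l // mulrA natrX -exprMn mulrC ler_wpM2r //.
    by rewrite lerXn2r ?nnegrE // mulr_ge0.
  rewrite mulrDr -[X in X <= _]add0r lerD ?mulr_ge0 // ler_wpM2r // ler_nat.
  by rewrite /C -addnA leq_addr.
have le1 : N%:R <= K'%:R * s ^+ (n * n - 1).
  apply: le_trans (_ : K'%:R * b ^+ (n * n - 1) <= _).
    rewrite -natrX -natrM ler_nat; have := card_det0_le gD n0 isT.
    by rewrite cT; apply; rewrite addn_gt0 orbT.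
  by rewrite ler_wpM2l // lerXn2r ?nnegrE // ltW.
have le2 : b ^+ (n * n) / p%:R <= s ^+ (n * n - 1).
  rewrite ler_pdivrMr ?ltr0n ?prime_gt0 // -s2 -exprD.
  apply: le_trans (_ : s ^+ (n * n) <= _); first by rewrite lerXn2r ?nnegrE // ltW.
  by rewrite ler_weXn2l //; (clear - n0; lia).
apply: le_trans (ler_normB _ _) _.
rewrite !ger0_norm ?divr_ge0 ?exprn_ge0 // mulrDr -[X in X <= _]addr0.
rewrite lerD ?mulr_ge0 //; apply: le_trans (lerD le1 le2) _.
rewrite -[X in _ + X <= _]mul1r -mulrDl ler_wpM2r // natr1 ler_nat /C.
by rewrite addn1 ltnS leq_addl.
Qed.
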